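(* Let $\mathcal{H}$ be a Hilbert space of finite dimension $d\ge2$, let $\mathcal{F}(\mathcal{H})\subseteq\mathcal{D}(\mathcal{H})$ be a closed set of free states (not assumed convex), and let $\rho\in\mathcal{D}(\mathcal{H})\setminus\mathcal{F}(\mathcal{H})$. Then there exists a family of channel ensembles $\big(\{p_i,\Lambda_i^{(m)}\}_i\big)_{m=2}^d$ such that \[\min_{\sigma\in\mathcal{F}(\mathcal{H})}\ \max_{m=2,\dots,d}\ \frac{\max_{\{M_i^{(m)}\}_i}p_{\mathrm{succ}}(\{p_i,\Lambda_i^{(m)}\}_i,\{M_i^{(m)}\}_i,\rho^{\otimes m})}{\max_{\{M_i^{(m)}\}_i}p_{\mathrm{succ}}(\{p_i,\Lambda_i^{(m)}\}_i,\{M_i^{(m)}\}_i,\sigma^{\otimes m})}>1.\]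
   Context: $\mathcal{D}(\mathcal{H})$ is the set of density operators on $\mathcal{H}$. A channel ensemble $\{p_i,\Lambda_i^{(m)}\}_i$ is a finite probability distribution $(p_i)_i$ together with quantum channels (completely positive trace-preserving maps) $\Lambda_i^{(m)}$ from operators on $\mathcal{H}^{\otimes m}$ to operators on a common finite-dimensional output space. For a POVM $\{M_i\}_i$ on the output space (same index set) and a state $\omega$ on $\mathcal{H}^{\otimes m}$, the success probability is $p_{\mathrm{succ}}(\{p_i,\Lambda_i^{(m)}\}_i,\{M_i\}_i,\omega)=\sum_ip_i\operatorname{tr}[M_i\Lambda_i^{(m)}(\omega)]$; the maxima are over all such POVMs. *)

(* Defs.v *)
From HB Require Import structures.
From mathcomp Require Import all_boot all_order all_algebra.
From mathcomp Require Import classical_sets reals.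
From mathcomp Require Export complex mxtens.
Set Implicit Arguments. Unset Strict Implicit. Unset Printing Implicit Defensive.
Import Order.TTheory GRing.Theory Num.Theory.
Local Open Scope ring_scope.
Local Open Scope complex_scope.

Section QDefs.
Variable R : realType.
Local Notation C := (R[i]).

Definition psd n (A : 'M[C]_n) : Prop :=
  forall v : 'cV[C]_n, 0 <= ((map_mx Num.conj v)^T *m A *m v) 0 0.

Definition density n (A : 'M[C]_n) : Prop := psd A /\ \tr A = 1.

Definition closed_mx n (F : 'M[C]_n -> Prop) : Prop :=
  forall tau, ~ F tau -> exists2 eps : C, 0 < eps &
    forall sigma : 'M[C]_n, (forall i j, `|sigma i j - tau i j| < eps) -> ~ F sigma.

Definition mxblock_of r D (X : 'M[C]_(r * D)) (i j : 'I_r) : 'M[C]_D :=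
  \matrix_(a, b) X (mxtens_index (i, a)) (mxtens_index (j, b)).

Definition id_tens r D k (Lam : 'M[C]_D -> 'M[C]_k) (X : 'M[C]_(r * D))
  : 'M[C]_(r * k) :=
  \sum_(i < r) \sum_(j < r) (delta_mx i j *t Lam (mxblock_of X i j)).

Definition channel D k (Lam : 'M[C]_D -> 'M[C]_k) : Prop :=
  [/\ (forall (a : C) X Y, Lam (a *: X + Y) = a *: Lam X + Lam Y),
      (forall r (X : 'M[C]_(r * D)), psd X -> psd (id_tens Lam X)) &
      (forall X, \tr (Lam X) = \tr X)].

Definition prob_distr n (p : 'I_n -> R) : Prop :=
  (forall i, 0 <= p i) /\ \sum_(i < n) p i = 1.

Definition povm n k (M : 'I_n -> 'M[C]_k) : Prop :=
  (forall i, psd (M i)) /\ \sum_(i < n) M i = 1%:M.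

Fixpoint tdim (d m : nat) : nat :=
  match m with 0 => 1%N | m'.+1 => (tdim d m' * d)%N end.

Fixpoint tpow d (A : 'M[C]_d) (m : nat) : 'M[C]_(tdim d m) :=
  match m with 0 => 1%:M | m'.+1 => tpow A m' *t A end.

(* success probability sum_i p_i tr[M_i Lam_i(omega)] (its real part; it is real) *)
Definition p_succ n D k (p : 'I_n -> R) (Lam : 'I_n -> 'M[C]_D -> 'M[C]_k)
  (M : 'I_n -> 'M[C]_k) (omega : 'M[C]_D) : R :=
  complex.Re (\sum_(i < n) (p i)%:C * \tr (M i *m Lam i omega)).

Definition max_succ n D k (p : 'I_n -> R) (Lam : 'I_n -> 'M[C]_D -> 'M[C]_k)
  (omega : 'M[C]_D) : R :=
  sup [set x : R | exists M : 'I_n -> 'M[C]_k, povm M /\ x = p_succ p Lam M omega].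

Definition advantage d n k (p : 'I_n -> R)
  (Lam : forall m : nat, 'I_n -> 'M[C]_(tdim d m) -> 'M[C]_k)
  (rho sigma : 'M[C]_d) : R :=
  \big[Num.max/0]_(2 <= m < d.+1)
     (max_succ p (Lam m) (tpow rho m) / max_succ p (Lam m) (tpow sigma m)).

End QDefs.

(* Main.v *)
(** Two copies suffice. Since [sigma] has trace 1, the squared Hilbert-Schmidt
    distance from [sigma] to [rho] is [tr (W (sigma (x) sigma))] for the Hermitian
    operator [W = sum_ij (e_ji - rho_ij 1) (x) (e_ij - rho_ji 1)], and closedness
    of [F] keeps this distance bounded away from 0 on [F]. For [c] large,
    [E = (c 1 - W) / (2 c)] satisfies [0 <= E <= 1]. Take the uniform ensemble of
    two channels: the first measures [{E, 1 - E}] and outputs the outcome, the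
    second always outputs outcome 1. The optimal success probability on [omega]
    is then [(1 + tr (E omega)) / 2], which for [omega = sigma (x) sigma] is
    largest, by a uniform margin, at [sigma = rho]. *)
Require Import Defs.
From HB Require Import structures.
From mathcomp Require Import all_boot all_order all_algebra.
From mathcomp Require Import classical_sets reals.
From mathcomp Require Import complex mxtens spectral ring lra.
Import Order.TTheory GRing.Theory Num.Theory.
Local Open Scope ring_scope.
Set Implicit Arguments. Unset Strict Implicit.

(** * Conjugate transposes and quadratic forms *)

Definition adjmx (C : numClosedFieldType) m n (A : 'M[C]_(m, n)) : 'M[C]_(n, m) :=
  (map_mx Num.conj A)^T.

Section Adj.
Variable C : numClosedFieldType.
Local Notation adj := (@adjmx C _ _).

Lemma adjmxE m n (A : 'M[C]_(m, n)) i j : adj A i j = (A j i)^*.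
Proof. by rewrite !mxE. Qed.

Lemma adjmxM m n p (A : 'M[C]_(m, n)) (B : 'M[C]_(n, p)) :
  adj (A *m B) = adj B *m adj A.
Proof. by rewrite /adjmx map_mxM trmx_mul. Qed.

Lemma adjmxK m n (A : 'M[C]_(m, n)) : adj (adj A) = A.
Proof. by apply/matrixP => i j; rewrite !adjmxE conjCK. Qed.

Lemma adjmxD m n (A B : 'M[C]_(m, n)) : adj (A + B) = adj A + adj B.
Proof. by apply/matrixP => i j; rewrite !mxE rmorphD. Qed.

Lemma adjmxZ m n (c : C) (A : 'M[C]_(m, n)) : adj (c *: A) = c^* *: adj A.
Proof. by apply/matrixP => i j; rewrite !mxE rmorphM. Qed.

Lemma adjmx_delta m n i j : adj (delta_mx i j : 'M[C]_(m, n)) = delta_mx j i.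
Proof. by rewrite /adjmx map_delta_mx trmx_delta. Qed.

Lemma adjmx_tens m n p q (A : 'M[C]_(m, n)) (B : 'M[C]_(p, q)) :
  adj (A *t B) = adj A *t adj B.
Proof. by rewrite /adjmx map_mxT trmx_tens. Qed.

Lemma gram_form_ge0 m n (B : 'M[C]_(m, n)) (i : 'I_n) : 0 <= (adj B *m B) i i.
Proof. by rewrite mxE sumr_ge0 // => k _; rewrite adjmxE mulrC mul_conjC_ge0. Qed.

Lemma form_sumE n (A : 'M[C]_n) (v : 'cV[C]_n) :
  (adj v *m A *m v) 0 0 = \sum_i \sum_j (v i 0)^* * A i j * v j 0.
Proof.
rewrite mxE; under eq_bigr => j _.
  rewrite mxE mulr_suml; under eq_bigr => i _ do rewrite adjmxE.
  over.
by rewrite exchange_big.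
Qed.

Lemma tr_tens m n (A : 'M[C]_m) (B : 'M[C]_n) : \tr (A *t B) = \tr A * \tr B.
Proof.
by rewrite /mxtrace mulr_sum; apply: eq_bigr => i _; rewrite mxE.
Qed.

End Adj.

(** * Positive semidefinite matrices *)

Section Psd.
Variable R : realType.
Local Notation C := (R[i]).
Local Notation adj := (@adjmx C _ _).

Lemma psd_gram m n (B : 'M[C]_(m, n)) : psd (adj B *m B).
Proof.
move=> v; rewrite -[(_ ^T)%R]/(adj v) -mulmxA -!mulmxA mulmxA -adjmxM.
exact: gram_form_ge0.
Qed.

Lemma psd_form (n : nat) (A : 'M[C]_n) (v : 'cV[C]_n) :
  psd A -> 0 <= (adj v *m A *m v) 0 0.
Proof. by move=> /(_ v). Qed.

Lemma psd1 n : psd (1%:M : 'M[C]_n).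
Proof. by have := @psd_gram n n 1%:M; rewrite mulmx1 /adjmx map_mx1 trmx1. Qed.

Lemma psd0 n : psd (0 : 'M[C]_n).
Proof. by move=> v; rewrite mulmx0 mul0mx mxE. Qed.

Lemma psdZ n (c : C) (A : 'M[C]_n) : 0 <= c -> psd A -> psd (c *: A).
Proof. by move=> c0 hA v; rewrite -scalemxAr -scalemxAl mxE mulr_ge0. Qed.

Lemma psd_diag_ge0 n (A : 'M[C]_n) i : psd A -> 0 <= A i i.
Proof.
move=> /(_ (delta_mx i 0)); rewrite map_delta_mx trmx_delta -rowE -colE.
by rewrite !mxE.
Qed.

Lemma psd_tr_ge0 n (A : 'M[C]_n) : psd A -> 0 <= \tr A.
Proof. by move=> hA; apply: sumr_ge0 => i _; apply: psd_diag_ge0. Qed.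

(** [psd] only constrains the form, so hermiticity comes by polarization: the form at [e_i + c e_j]
    and the diagonal entries are real, which leaves [c A_ij + c^* A_ji] real for every [c]. Taking
    [c = 1] and [c = 'i] forces [A_ij] and [A_ji] to be conjugate. *)
Lemma psd_adjmx n (A : 'M[C]_n) : psd A -> adj A = A.
Proof.
move=> hA; apply/matrixP => i j; rewrite adjmxE.
have key (c : C) : c * A i j + c^* * A j i \is Num.real.
  have := psd_form (delta_mx i 0 + c *: delta_mx j 0) hA.
  rewrite adjmxD adjmxZ !adjmx_delta !mulmxDl !mulmxDr -?scalemxAl -?scalemxAr -?scalemxAl.
  rewrite -!rowE -!colE !mxE => /ger0_real.
  have ri := ger0_real (psd_diag_ge0 i hA).
  have rj := ger0_real (psd_diag_ge0 j hA).
  set q := (X in X \is _) => hq.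
  have -> : c * A i j + c^* * A j i = q - A i i - (c * c^*) * A j j.
    rewrite /q; ring.
  by rewrite !rpredB // rpredM // ger0_real // mul_conjC_ge0.
have := key 1; have := key 'i.
rewrite conjCi conjC1 !mul1r.
move=> /CrealP; rewrite rmorphD !rmorphM rmorphN /= conjCi => h1.
move=> /CrealP; rewrite rmorphD /= => h2.
have {}h1 : (A i j)^* - (A j i)^* = A j i - A i j.
  apply: (mulfI (neq0Ci C)).
  transitivity (- (- 'i * (A i j)^* + - - 'i * (A j i)^*)); first by ring.
  by rewrite h1; ring.
have h : 2 * (A j i)^* = 2 * A i j.
  transitivity ((A i j)^* + (A j i)^* - ((A i j)^* - (A j i)^*)); first by ring.
  by rewrite h2 h1; ring.
by apply: mulfI h; rewrite pnatr_eq0.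
Qed.

(** By the spectral theorem [A = adj P *m diag_mx s *m P] with [P] unitary. The eigenvalues are
    diagonal entries of the psd matrix [P *m A *m adj P], so their square roots give the factor. *)
Lemma psd_factor n (A : 'M[C]_n) : psd A -> exists B : 'M[C]_n, A = adj B *m B.
Proof.
move=> hA.
have /orthomx_spectralP : A \is normalmx.
  by apply/normalmxP; rewrite -map_trmx -/(adj A) (psd_adjmx hA).
set P := spectralmx A; set s := spectral_diag A => /= eA.
have uP : P \is unitarymx by apply: spectral_unitarymx.
have PK : P *m adj P = 1%:M by move: uP => /unitarymxP; rewrite -map_trmx.
have iP : invmx P = adj P by rewrite invmx_unitary // -map_trmx.
have sE : diag_mx s = P *m A *m adj P.
  by rewrite eA iP !mulmxA PK mul1mx -mulmxA PK mulmx1.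
have s0 i : 0 <= s 0 i.
  have : psd (diag_mx s).
    move=> v; rewrite -[(_ ^T)%R]/(adj v) sE -!mulmxA.
    have := psd_form (adj P *m v) hA.
    by rewrite adjmxM adjmxK -!mulmxA.
  by move=> /(psd_diag_ge0 i); rewrite mxE eqxx mulr1n.
exists (diag_mx (\row_i sqrtC (s 0 i)) *m P).
rewrite adjmxM -mulmxA (mulmxA (adj _) _ P) {1}eA iP -mulmxA; do 2 congr (_ *m _).
rewrite /adjmx map_diag_mx tr_diag_mx mulmx_diag; congr diag_mx.
by apply/rowP => i; rewrite !mxE /= geC0_conj ?sqrtC_ge0 // -expr2 sqrtCK.
Qed.

(** Writing [B = adj G *m G], cyclicity turns the trace into that of the psd matrix
    [G *m A *m adj G]. *)
Lemma psd_tr_mul n (A B : 'M[C]_n) : psd A -> psd B -> 0 <= \tr (A *m B).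
Proof.
move=> hA /psd_factor [G ->]; rewrite mulmxA mxtrace_mulC.
apply: psd_tr_ge0 => v; rewrite -[(_ ^T)%R]/(adj v).
by have := psd_form (adj G *m v) hA; rewrite adjmxM adjmxK -!mulmxA.
Qed.

Lemma psd_tens m n (A : 'M[C]_m) (B : 'M[C]_n) : psd A -> psd B -> psd (A *t B).
Proof.
move=> /psd_factor [G ->] /psd_factor [H ->].
by rewrite -tensmx_mul -adjmx_tens; apply: psd_gram.
Qed.

End Psd.

(** * Measurement channels and discrimination of two of them *)

Section Channels.
Variable R : realType.
Local Notation C := (R[i]).
Local Notation adj := (@adjmx C _ _).

(** The form of [H] at [v] is real and at most the sum of [|H_ij| |v_i| |v_j|], where each
    [|v_i| |v_j|] is bounded by the squared norm [N] of [v] through the arithmetic-geometric mean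
    inequality. *)
Lemma psd_shift n (H : 'M[C]_n) (c : C) :
  adj H = H -> \sum_i \sum_j `|H i j| <= c -> psd (c%:M - H).
Proof.
move=> hH hc v; rewrite -[(_ ^T)%R]/(adj v) mulmxBr mulmxBl mul_mx_scalar -scalemxAl.
pose N := (adj v *m v) 0 0.
have N0 : 0 <= N by apply: gram_form_ge0.
have NE : N = \sum_i `|v i 0| ^+ 2.
  by rewrite /N mxE; apply: eq_bigr => i _; rewrite adjmxE mulrC normCK.
have -> (A B : 'M[C]_1) : (c *: A - B) 0 0 = c * A 0 0 - B 0 0 by rewrite !mxE.
rewrite subr_ge0 -/N.
have hreal : (adj v *m H *m v) 0 0 \is Num.real.
  by apply/CrealP; rewrite -adjmxE !adjmxM adjmxK hH -!mulmxA.
have vN i : `|v i 0| ^+ 2 <= N.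
  by rewrite NE (bigD1 i) //= lerDl sumr_ge0 // => j _; rewrite exprn_ge0.
have vvN i j : `|v i 0| * `|v j 0| <= N.
  rewrite -(ler_pM2l (ltr0Sn _ 1)) mulr_natl.
  apply: (@le_trans _ _ (`|v i 0| ^+ 2 + `|v j 0| ^+ 2)); last by rewrite mulr_natl mulr2n lerD.
  rewrite -subr_ge0.
  have -> : `|v i 0| ^+ 2 + `|v j 0| ^+ 2 - (`|v i 0| * `|v j 0|) *+ 2
    = (`|v i 0| - `|v j 0|) ^+ 2 by ring.
  by rewrite real_exprn_even_ge0 // rpredB // normr_real.
apply: (le_trans (real_ler_norm hreal)); rewrite form_sumE.
apply: (le_trans (ler_norm_sum _ _ _)).
apply: (@le_trans _ _ (\sum_i \sum_j `|H i j| * N)); last first.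
  under eq_bigr => i _ do rewrite -mulr_suml.
  by rewrite -mulr_suml ler_wpM2r.
apply: ler_sum => i _; apply: (le_trans (ler_norm_sum _ _ _)).
apply: ler_sum => j _; rewrite !normrM norm_conjC mulrAC mulrC.
by rewrite ler_wpM2l.
Qed.

Lemma sum_mxtens (V : nmodType) m n (F : 'I_(m * n) -> V) :
  \sum_x F x = \sum_i \sum_j F (mxtens_index (i, j)).
Proof.
rewrite pair_big /= (reindex (@mxtens_index m n)); last first.
  by exists (@mxtens_unindex m n) => x _; rewrite (mxtens_indexK, mxtens_unindexK).
by apply: eq_bigr => -[].
Qed.

Lemma id_tensE r D k (Lam : 'M[C]_D -> 'M[C]_k) X i a j b :
  id_tens Lam X (mxtens_index (i, a)) (mxtens_index (j, b))
  = Lam (@mxblock_of R r D X i j) a b.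
Proof.
rewrite /id_tens summxE (bigD1 i) //= summxE (bigD1 j) //= tensmxE mxE !eqxx mul1r.
rewrite big1 ?addr0 => [|j' nj]; last first.
  by rewrite tensmxE mxE eqxx eq_sym (negPf nj) mul0r.
rewrite big1 ?addr0 // => i' ni; rewrite summxE big1 // => j' _.
by rewrite tensmxE mxE eq_sym (negPf ni) mul0r.
Qed.

(* The form at [w] is the form of [X] at [u (x) w]. *)
Lemma psd_block_form r D (X : 'M[C]_(r * D)) (u : 'I_r -> C) : psd X ->
  psd (\sum_i \sum_j ((u i)^* * u j) *: mxblock_of X i j).
Proof.
move=> hX w; rewrite -[(_ ^T)%R]/(adj w) form_sumE.
pose z : 'cV[C]_(r * D) :=
  \col_x (u (mxtens_unindex x).1 * w (mxtens_unindex x).2 0).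
have := psd_form z hX; rewrite form_sumE; congr (0 <= _).
rewrite sum_mxtens exchange_big; apply: eq_bigr => a _ /=.
under eq_bigr => i _ do rewrite sum_mxtens exchange_big.
rewrite exchange_big; apply: eq_bigr => b _ /=.
rewrite summxE mulr_sumr mulr_suml; apply: eq_bigr => i _.
rewrite summxE mulr_sumr mulr_suml; apply: eq_bigr => j _.
rewrite !mxE !mxtens_indexK /= rmorphM /=.
ring.
Qed.

Lemma sum_ord2 (V : nmodType) (F : 'I_2 -> V) : \sum_i F i = F 0 + F 1.
Proof.
by rewrite !big_ord_recl big_ord0 addr0; congr (F _ + F _); apply/val_inj.
Qed.

(** The outcome is recorded classically, as a diagonal matrix. *)
Definition measure_channel k D (E : 'I_k -> 'M[C]_D) (X : 'M[C]_D) : 'M[C]_k :=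
  diag_mx (\row_a \tr (E a *m X)).

(** For complete positivity, diagonal outputs split the form at [v] into a sum over outcomes [a] of
    [tr (E_a Y_a)], with [Y_a] the psd block combination of [X] for the coefficients [v_(i,a)]. *)
Lemma measure_channelP k D (E : 'I_k -> 'M[C]_D) :
  povm E -> channel (measure_channel E).
Proof.
move=> [hE E1]; split.
- move=> a X Y; apply/matrixP => i j; rewrite !mxE mulmxDr -scalemxAr.
  by rewrite mxtraceD mxtraceZ mulrnDl mulrnAr.
- move=> r X hX v; rewrite -[(_ ^T)%R]/(adj v) form_sumE.
  rewrite sum_mxtens exchange_big sumr_ge0 //= => a _.
  have := psd_tr_mul (hE a)
    (psd_block_form (fun i => v (mxtens_index (i, a)) 0) hX).
  rewrite mulmx_sumr raddf_sum /=; congr (0 <= _); apply: eq_bigr => i _.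
  rewrite mulmx_sumr raddf_sum sum_mxtens; apply: eq_bigr => j _ /=.
  rewrite (bigD1 a) //= big1 ?addr0 => [|b nb]; last first.
    by rewrite id_tensE !mxE eq_sym (negPf nb) mulr0n mulr0 mul0r.
  rewrite id_tensE !mxE eqxx mulr1n -scalemxAr mxtraceZ; ring.
- move=> X; rewrite mxtrace_diag; under eq_bigr => a _ do rewrite mxE.
  by rewrite -raddf_sum -mulmx_suml E1 mul1mx.
Qed.

Definition binary_effect D (E : 'M[C]_D) (a : 'I_2) : 'M[C]_D :=
  if a == 0 then E else 1%:M - E.

Lemma binary_effectP D (E : 'M[C]_D) :
  psd E -> psd (1%:M - E) -> povm (binary_effect E).
Proof.
move=> h0 h1; split => [i|]; first by rewrite /binary_effect; case: ifP.
by rewrite sum_ord2 /binary_effect /= addrC subrK.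
Qed.

(** The effect 0 given to channel 1 is what makes its outcome always 1. *)
Definition effect_ensemble D (E : 'M[C]_D) (i : 'I_2) : 'M[C]_D -> 'M[C]_2 :=
  measure_channel (binary_effect (if i == 0 then E else 0)).

Lemma p_succ_effect D (E omega : 'M[C]_D) (M : 'I_2 -> 'M[C]_2) (t : R) :
  \tr omega = 1 -> \tr (E *m omega) = t%:C%C ->
  p_succ (fun=> 2^-1) (effect_ensemble E) M omega =
  complex.Re (2^-1 * (M 0 0 0 * t%:C%C + M 0 1 1 * (1 - t%:C%C) + M 1 1 1)).
Proof.
move=> tr1 trE; rewrite /p_succ; congr complex.Re.
have trD (A : 'M[C]_2) (s : 'rV_2) : \tr (A *m diag_mx s) = \sum_a A a a * s 0 a.
  by rewrite /mxtrace; apply: eq_bigr => a _; rewrite mul_mx_diag mxE.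
rewrite sum_ord2 !trD !sum_ord2 !mxE /binary_effect /=.
rewrite /= !mulmxBl !mul1mx !mul0mx subr0 raddfB /= tr1 trE mxtrace0.
rewrite fmorphV rmorph_nat; ring.
Qed.

Lemma Re_half (t : R) : complex.Re (2^-1 * (1 + t%:C%C) : C) = 2^-1 * (1 + t).
Proof.
by rewrite -(rmorph1 (real_complex R)) -rmorphD -(rmorph_nat (real_complex R) 2)
  -fmorphV -rmorphM.
Qed.

(** The best strategy guesses the channel whose index is the observed outcome, that is, it measures
    in the standard basis. *)
Lemma max_succ_effect D (E omega : 'M[C]_D) (t : R) :
  \tr omega = 1 -> \tr (E *m omega) = t%:C%C -> 0 <= t ->
  max_succ (fun=> 2^-1) (effect_ensemble E) omega = 2^-1 * (1 + t).
Proof.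
move=> tr1 trE t0; rewrite /max_succ.
set S := (X in sup X).
have ubS : ubound S (2^-1 * (1 + t)).
  move=> _ [M [[M0 M1] ->]]; rewrite (p_succ_effect M tr1 trE).
  rewrite -Re_half.
  suff : 2^-1 * (M 0 0 0 * t%:C%C + M 0 1 1 * (1 - t%:C%C) + M 1 1 1) <=
    2^-1 * (1 + t%:C%C) :> C by rewrite lecE => /andP[].
  rewrite ler_pM2l ?invr_gt0 ?ltr0n //.
  have s0 : M 0 0 0 + M 1 0 0 = 1.
    by move/matrixP/(_ 0 0): M1; rewrite sum_ord2 !mxE.
  have s1 : M 0 1 1 + M 1 1 1 = 1.
    by move/matrixP/(_ 1 1): M1; rewrite sum_ord2 !mxE.
  have tC : 0 <= t%:C%C :> C by rewrite lecR.
  have -> : M 1 1 1 = 1 - M 0 1 1 by rewrite -s1; ring.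
  have -> : M 0 0 0 = 1 - M 1 0 0 by rewrite -s0; ring.
  rewrite -subr_ge0.
  (* The loss of an arbitrary POVM is governed by its two wrong-guess entries: [M_1] at outcome 0
     and [M_0] at outcome 1. *)
  set a := M 1 0 0; set b := M 0 1 1.
  have -> : 1 + t%:C%C - ((1 - a) * t%:C%C + b * (1 - t%:C%C) + (1 - b))
    = (a + b) * t%:C%C by ring.
  by rewrite mulr_ge0 // addr_ge0 // psd_diag_ge0.
have inS : S (2^-1 * (1 + t)).
  exists (fun i : 'I_2 => delta_mx i i); split.
    split=> [i|]; last first.
      apply/matrixP => i j; rewrite summxE sum_ord2 !mxE.
      by case: i j => [[|[|//]] ?] [[|[|//]] ?]; rewrite /= ?addr0 ?add0r.
    by have := @psd_gram R _ _ (delta_mx i i); rewrite adjmx_delta mul_delta_mx.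
  rewrite (p_succ_effect _ tr1 trE) -Re_half !mxE.
  by congr (complex.Re (_ * _)); rewrite /=; ring.
apply/le_anti/andP; split; last by apply: ub_le_sup => //; exists (2^-1 * (1 + t)).
by apply: ge_sup => //; exists (2^-1 * (1 + t)).
Qed.

End Channels.

(** * The two-copy distance witness and its effect *)

Section Witness.
Variables (R : realType) (d : nat).
Local Notation C := (R[i]).
Local Notation adj := (@adjmx C _ _).

Definition hs_dist2 (rho sigma : 'M[C]_d) : C :=
  \sum_i \sum_j `|sigma i j - rho i j| ^+ 2.

(** The leading [1%:M] is the 1-by-1 matrix with which [tpow] starts. *)
Definition dist_witness (rho : 'M[C]_d) : 'M[C]_(tdim d 2) :=
  \sum_i \sum_j (1%:M *t (delta_mx j i - (rho i j)%:M))
                *t (delta_mx i j - (rho j i)%:M).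

Lemma hs_dist2_real (rho sigma : 'M[C]_d) :
  hs_dist2 rho sigma = (complex.Re (hs_dist2 rho sigma))%:C%C.
Proof.
rewrite RRe_real // ger0_real // sumr_ge0 // => i _.
by rewrite sumr_ge0 // => j _; rewrite exprn_ge0.
Qed.

(** Each term factors as [(sigma_ij - rho_ij) (sigma_ji - rho_ji)], the scalar parts using
    [tr sigma = 1]; hermiticity makes the factors conjugate. *)
Lemma tr_dist_witness (rho sigma : 'M[C]_d) : density rho -> density sigma ->
  \tr (dist_witness rho *m tpow sigma 2) = hs_dist2 rho sigma.
Proof.
move=> [hr _] [hs tr1]; rewrite /= mulmx_suml raddf_sum; apply: eq_bigr => i _.
rewrite mulmx_suml raddf_sum; apply: eq_bigr => j _ /=.
have trE k l a : \tr ((delta_mx k l - a%:M) *m sigma) = sigma l k - a.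
  rewrite mulmxBl mul_scalar_mx raddfB /= mxtraceZ tr1 mulr1; congr (_ - _).
  rewrite /mxtrace (bigD1 k) //= big1 => [|m nm]; last first.
    by rewrite mxE big1 // => l' _; rewrite mxE (negPf nm) mul0r.
  rewrite addr0 mxE (bigD1 l) //= big1 => [|m nm]; last first.
    by rewrite mxE (negPf nm) andbF mul0r.
  by rewrite mxE !eqxx mul1r addr0.
rewrite !tensmx_mul !tr_tens mul1mx mxtrace1 mul1r !trE normCK rmorphB /=.
by rewrite -!adjmxE !psd_adjmx.
Qed.

(** The adjoint of the [(i, j)] term is the [(j, i)] term. *)
Lemma adjmx_dist_witness (rho : 'M[C]_d) :
  density rho -> adj (dist_witness rho) = dist_witness rho.
Proof.
move=> [hr _].
have adjB k l a : adj (delta_mx k l - a%:M : 'M[C]_d) = delta_mx l k - (a^*)%:M.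
  by apply/matrixP => i j; rewrite !mxE rmorphB !rmorphMn /= conjC1 andbC (eq_sym j i).
have adj_sum (I : finType) (G : I -> 'M[C]_(tdim d 2)) :
    adj (\sum_i G i) = \sum_i adj (G i).
  by rewrite /adjmx map_mx_sum raddf_sum.
rewrite [RHS]exchange_big /dist_witness adj_sum; apply: eq_bigr => i _.
rewrite adj_sum; apply: eq_bigr => j _.
rewrite !adjmx_tens !adjB -!adjmxE (psd_adjmx hr). congr (_ *t _ *t _).
by rewrite /adjmx map_mx1 trmx1.
Qed.

Lemma psd_tpow (sigma : 'M[C]_d) m : psd sigma -> psd (tpow sigma m).
Proof. by move=> hs; elim: m => [|m IH] /=; [apply: psd1 | apply: psd_tens]. Qed.

Lemma tr_tpow (sigma : 'M[C]_d) m : \tr sigma = 1 -> \tr (tpow sigma m) = 1.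
Proof. by move=> h; elim: m => [|m IH] /=; rewrite ?mxtrace1 // tr_tens IH h mul1r. Qed.

Lemma dist_effect (rho : 'M[C]_d) : density rho ->
  exists (b : R) (E : 'M[C]_(tdim d 2)),
    [/\ 0 < b, psd E, psd (1%:M - E) &
        forall sigma, density sigma -> \tr (E *m tpow sigma 2)
          = (2^-1 - b * complex.Re (hs_dist2 rho sigma))%:C%C].
Proof.
move=> hr; pose W := dist_witness rho.
(* The sum dominates both [W] and [- W]; the added 1 makes [c] invertible. *)
pose c := 1 + \sum_i \sum_j complex.Re `|W i j|.
have c0 : 0 < c.
  rewrite ltr_pwDl // sumr_ge0 // => i _; rewrite sumr_ge0 // => j _.
  by rewrite -lecR (RRe_real (normr_real _)); apply: normr_ge0.
have Wc : \sum_i \sum_j `|W i j| <= c%:C%C.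
  rewrite /c rmorphD rmorph1 -[X in X <= _]add0r lerD ?ler01 //.
  rewrite rmorph_sum ler_sum // => i _.
  by rewrite rmorph_sum ler_sum.
have Wadj : adj W = W by apply: adjmx_dist_witness.
have hm : psd (c%:C%C%:M - W) by apply: psd_shift.
have hp : psd (c%:C%C%:M - - W).
  apply: psd_shift; first by rewrite -scaleN1r adjmxZ rmorphN1 Wadj.
  by under eq_bigr => i _ do under eq_bigr => j _ do rewrite mxE normrN.
have k0 : 0 <= (2^-1 * c^-1)%:C%C :> C.
  by rewrite lecR mulr_ge0 // invr_ge0 ?ler0n // ltW.
exists (2^-1 * c^-1), ((2^-1 * c^-1)%:C%C *: (c%:C%C%:M - W)); split.
- by rewrite mulr_gt0 ?invr_gt0 ?ltr0n.
- exact: psdZ.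
- suff -> : 1%:M - (2^-1 * c^-1)%:C%C *: (c%:C%C%:M - W)
    = (2^-1 * c^-1)%:C%C *: (c%:C%C%:M - - W) by apply: psdZ.
  apply/eqP; rewrite subr_eq -scalerDr opprK addrACA subrr addr0 -raddfD.
  rewrite scale_scalar_mx -rmorphD -rmorphM; apply/eqP; congr (_%:M).
  by rewrite -(rmorph1 (real_complex R)); congr (_%:C%C); field; rewrite gt_eqF.
- move=> sigma hs; rewrite -scalemxAl mxtraceZ mulmxBl mul_scalar_mx raddfB /=.
  rewrite mxtraceZ (tr_tpow 2 hs.2) tr_dist_witness // {1}hs_dist2_real mulr1.
  rewrite -rmorphB -rmorphM; congr (_%:C%C).
  by field; rewrite gt_eqF.
Qed.

(** The ratio equals [1 / (1 - 2 y / 3)], which is at least [1 + 2 y / 3]. *)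
Lemma ratio_lower_bound (x y : R) : 0 <= x -> x <= y -> 0 <= 2^-1 - y ->
  1 + 2 / 3 * x <= 2^-1 * (1 + 2^-1) / (2^-1 * (1 + (2^-1 - y))).
Proof.
move=> x0 xy y1; rewrite ler_pdivlMr; last by lra.
nra.
Qed.

End Witness.

(** * Uniform advantage over the free states *)

Unset Implicit Arguments. Set Strict Implicit.

Theorem theorem6 (R : realType) (d : nat) (hd : (2 <= d)%N)
  (F : 'M[R[i]]_d -> Prop)
  (hFD : forall sigma, F sigma -> density sigma)
  (hFc : closed_mx F)
  (rho : 'M[R[i]]_d) (hrho : density rho) (hrhoF : ~ F rho) :
  exists (n k : nat) (p : 'I_n -> R)
         (Lam : forall m : nat, 'I_n -> 'M[R[i]]_(tdim d m) -> 'M[R[i]]_k),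
    [/\ prob_distr p,
        (forall m : nat, (2 <= m <= d)%N -> forall i, channel (Lam m i)) &
        (* min_{sigma in F} max_m ratio > 1, i.e. the infimum exceeds 1 *)
        exists2 delta : R, 0 < delta &
          forall sigma, F sigma -> 1 + delta <= advantage p Lam rho sigma].
Proof.
have [eps eps0 farF] := hFc _ hrhoF.
have [b [E [b0 hE hE' trE]]] := dist_effect hrho.
(* Only two copies are exploited; elsewhere the effect 0 still yields legitimate channels. *)
pose effect m : 'M[R[i]]_(tdim d m) := match m with 2 => E | _ => 0 end.
have effectP m : psd (effect m) /\ psd (1%:M - effect m).
  have triv D : psd (0 : 'M[R[i]]_D) /\ psd (1%:M - 0 : 'M[R[i]]_D).
    by rewrite subr0; split; [exact: psd0 | exact: psd1].
  by case: m => [|[|[|m]]]; [exact: triv | exact: triv | split | exact: triv].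
exists 2, 2, (fun=> 2^-1), (fun m => effect_ensemble (effect m)).
have epsE : eps = (complex.Re eps)%:C%C by rewrite RRe_real // gtr0_real.
set e := complex.Re eps in epsE.
have e0 : 0 < e by rewrite epsE ltcR in eps0.
split.
- split=> [i|]; first by rewrite invr_ge0 ler0n.
  by rewrite sum_ord2; field.
- move=> m _ i; apply/measure_channelP/binary_effectP; case: ifP => _.
  + exact: (effectP m).1.
  + exact: psd0.
  + exact: (effectP m).2.
  + by rewrite subr0; exact: psd1.
(* This is [ratio_lower_bound] at [x = b * e ^+ 2], a gap independent of [sigma]. *)
exists (2 / 3 * (b * e ^+ 2)); first by rewrite !mulr_gt0 ?invr_gt0 ?exprn_gt0 ?ltr0n.
move=> sigma Fsigma; have hs := hFD _ Fsigma.
(* As [sigma] is free, it lies outside the entrywise ball around [rho]: some entry differs by at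
   least [eps], and its square alone bounds the distance. *)
have : e ^+ 2 <= complex.Re (hs_dist2 rho sigma).
  have [/existsP[i /existsP[j far]]|near] :=
    boolP [exists i, exists j, ~~ (`|sigma i j - rho i j| < eps)]; last first.
    case: (farF sigma _ Fsigma) => i j; apply: contraNT near => nij.
    by apply/existsP; exists i; apply/existsP; exists j.
  rewrite -lecR -hs_dist2_real rmorphXn /= -epsE.
  apply: (@le_trans _ _ (`|sigma i j - rho i j| ^+ 2)).
    move: far; rewrite -real_leNgt ?normr_real ?gtr0_real // => far.
    by rewrite lerXn2r ?nnegrE ?(ltW eps0) ?normr_ge0.
  rewrite /hs_dist2 (bigD1 i) //= (bigD1 j) //= -addrA lerDl addr_ge0 //.
    by rewrite sumr_ge0 // => l _; rewrite exprn_ge0.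
  by rewrite sumr_ge0 // => k _; rewrite sumr_ge0 // => l _; rewrite exprn_ge0.
set f := complex.Re _ => ef.
have t0 : 0 <= 2^-1 - b * f.
  have := psd_tr_mul hE (psd_tpow (m := 2) hs.1).
  by rewrite (trE _ hs) -[X in X <= _](rmorph0 (real_complex R)) lecR.
have succ_s : max_succ (fun=> 2^-1) (effect_ensemble E) (tpow sigma 2)
    = 2^-1 * (1 + (2^-1 - b * f)).
  exact: (max_succ_effect (tr_tpow 2 hs.2) (trE _ hs) t0).
have succ_r : max_succ (fun=> 2^-1) (effect_ensemble E) (tpow rho 2)
    = 2^-1 * (1 + 2^-1).
  have trEr : \tr (E *m tpow rho 2) = (2^-1)%:C%C.
    rewrite (trE _ hrho) /hs_dist2 big1 ?mulr0 ?subr0 // => i _.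
    by rewrite big1 // => j _; rewrite subrr normr0 expr0n.
  by apply: (max_succ_effect (tr_tpow 2 hrho.2) trEr); rewrite invr_ge0 ler0n.
apply: (@le_trans _ _ (2^-1 * (1 + 2^-1) / (2^-1 * (1 + (2^-1 - b * f))))).
  apply: ratio_lower_bound t0; last by rewrite ler_pM2l.
  by rewrite mulr_ge0 ?exprn_ge0 // ltW.
rewrite -succ_s -succ_r /advantage.
(* Since [d >= 2], the index 2 is in the range of the maximum. *)
pose ratio m := max_succ (fun=> 2^-1) (effect_ensemble (effect m)) (tpow rho m)
  / max_succ (fun=> 2^-1) (effect_ensemble (effect m)) (tpow sigma m).
by apply: (@le_bigmax_seq _ _ _ _ _ 2 xpredT ratio); rewrite ?mem_index_iota.
Qed.
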